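(* Let $n\ge1$. Every symbol on $\mathbb{P}^n(\mathbb{C})$ of the type $[w]\mapsto b(\sigma)$ belongs to $\mu_n^*(L^\infty(D_n))$, where $D_n=\mu_n(\mathbb{P}^n(\mathbb{C}))$ is the Delzant polytope of the projective space $\mathbb{P}^n(\mathbb{C})$. More precisely, $$\{b(\sigma) : b\in L^\infty(S_+^{n-1})\}\subset\{f\circ\mu_n : f\in L^\infty(D_n)\}.$$
   Context: $S_+^{n-1}$ is the set of points of the unit sphere of $\mathbb{R}^n$ with nonnegative coordinates (with surface measure; counting measure on a point if $n=1$). For $[w]\in\mathbb{P}^n(\mathbb{C})$ with $w_0\ne0$ put $z=(w_1,\dots,w_n)/w_0\in\mathbb{C}^n$ and, if $z\neq0$, $\sigma=(\sigma_1,\dots,\sigma_n)\in S_+^{n-1}$ with $\sigma_u=|z_u|/|z|$, $|z|$ the Euclidean norm; thus $b(\sigma)$ is defined for a.e. $[w]$. The torus $\mathbb{T}^n\simeq\{(t_0,\dots,t_n)\in\mathbb{T}^{n+1}:t_0\cdots t_n=1\}$ acts on $\mathbb{P}^n(\mathbb{C})$ by $t\cdot[w]=[t_0w_0,\dots,t_nw_n]$; this action is Hamiltonian for the Fubini–Study symplectic form, with moment map $$\mu_n:\mathbb{P}^n(\mathbb{C})\to\Big\{x\in\mathbb{R}^{n+1}:x_0+\dots+x_n=\tfrac12\Big\},\qquad\mu_n([w])=\frac{1}{2|w|^2}(|w_0|^2,\dots,|w_n|^2).$$ This formula is taken as the definition of $\mu_n$. $L^\infty(D_n)$ is with respect to $n$-dimensional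 Lebesgue measure on the affine hyperplane; functions are identified when equal almost everywhere. *)

(* Defs.v *)
From HB Require Import structures.
From mathcomp Require Import all_boot all_order all_algebra.
From mathcomp Require Import complex.
From mathcomp Require Import all_classical all_reals all_analysis.
Set Implicit Arguments.
Unset Strict Implicit.
Unset Printing Implicit Defensive.
Import Order.TTheory GRing.Theory Num.Theory.
Import numFieldNormedType.Exports.
Local Open Scope classical_set_scope.
Local Open Scope ring_scope.

(* |c| as an element of R; the norm of R[i] itself takes its values in R[i] *)
Notation modulus := ComplexField.Normc.normc.

(* R^n is n.-tuple R, whose sigma-algebra is the product of the Borel ones. *)
Fixpoint lebesgue_tuple (R : realType) (n : nat) : set (n.-tuple R) -> \bar R :=
  match n with
  | 0 => dirac [tuple]
  | m.+1 => pushforward (lebesgue_measure \x @lebesgue_tuple R m)%E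
              (fun p : measurableTypeR R * m.-tuple R => [tuple of (p.1 : R) :: p.2])
  end.
Arguments lebesgue_tuple {R} n.

Section pushforward_sigma_finite.
Context d1 d2 (T1 : measurableType d1) (T2 : measurableType d2) (R : realType).
Variables (mu : {measure set T1 -> \bar R}).
Hypothesis mu_sigma_finite : sigma_finite setT mu.
Variables (f : T1 -> T2) (g : T2 -> T1).
Hypothesis mf : measurable_fun [set: T1] f.
Hypothesis mg : measurable_fun [set: T2] g.
Hypothesis fK : cancel f g.

Let nu : set T2 -> \bar R := pushforward mu f.

Let nu_measure : exists m : {measure set T2 -> \bar R}, nu = m.
Proof. by unshelve eexists (pushforward mu f : {measure set T2 -> \bar R}). Qed.

Let nu0 : nu set0 = 0%E.
Proof. by have [m ->] := nu_measure; rewrite measure0. Qed.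

Let nu_ge0 A : (0 <= nu A)%E.
Proof. by have [m ->] := nu_measure; rewrite measure_ge0. Qed.

Let nu_sigma_additive : semi_sigma_additive nu.
Proof.
by have [m ->] := nu_measure; exact: measure_semi_sigma_additive.
Qed.

HB.instance Definition _ :=
  isMeasure.Build _ _ _ nu nu0 nu_ge0 nu_sigma_additive.

Let nu_sigma_finite : sigma_finite setT nu.
Proof.
have [F FT mF] := mu_sigma_finite.
exists (fun k => g @^-1` F k).
  apply/seteqP; split => // y _.
  have : setT (g y) by [].
  by rewrite FT => -[k _ Fk]; exists k.
move=> k; have [mFk Fkoo] := mF k; split.
  by rewrite -[X in measurable X]setTI; exact: mg.
rewrite /nu/= /pushforward (_ : f @^-1` _ = F k)//.
by apply/seteqP; split => x /=; rewrite fK.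
Qed.

HB.instance Definition _ :=
  Measure_isSigmaFinite.Build _ _ _ nu nu_sigma_finite.

Fact pushforward_sigma_finite_measure :
  exists m : {sigma_finite_measure set T2 -> \bar R}, pushforward mu f = m.
Proof. by exists nu. Qed.
End pushforward_sigma_finite.

Fact product_sigma_finite d1 d2 (T1 : measurableType d1)
    (T2 : measurableType d2) (R : realType)
    (m1 : {sigma_finite_measure set T1 -> \bar R})
    (m2 : {sigma_finite_measure set T2 -> \bar R}) :
  sigma_finite setT (m1 \x m2)%E.
Proof.
have /sigma_finiteP[F [TF ndF Foo]] := sigma_finiteT m1.
have /sigma_finiteP[G [TG ndG Goo]] := sigma_finiteT m2.
exists (fun n => F n `*` G n).
  rewrite -setXTT TF TG predeqE => -[x y]; split.
    move=> [/= [n _ Fnx] [k _ Gky]]; exists (maxn n k) => //; split.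
      by move: x Fnx; exact/subsetPset/ndF/leq_maxl.
    by move: y Gky; exact/subsetPset/ndG/leq_maxr.
  by move=> [n _ []/= ? ?]; split; exists n.
move=> k; have [? ?] := Foo k; have [? ?] := Goo k.
split; first exact: measurableX.
by rewrite product_measure1E// lte_mul_pinfty// ge0_fin_numE.
Qed.

Fact lebesgue_tuple_sigma_finite_measure (R : realType) n :
  exists m : {sigma_finite_measure set (n.-tuple R) -> \bar R},
    @lebesgue_tuple R n = m.
Proof.
elim: n => [|n [m /= ->]].
  by exists (dirac [tuple] : {sigma_finite_measure set _ -> \bar R}).
have mf : measurable_fun [set: measurableTypeR R * n.-tuple R]
    (fun p => [tuple of (p.1 : R) :: p.2]).
  have m1 : measurable_fun [set: measurableTypeR R * n.-tuple R]
      (fun p => p.1 : R) by exact: measurable_fst.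
  exact: (measurable_cons m1 measurable_snd).
have mg : measurable_fun [set: n.+1.-tuple R]
    (fun y => (thead y : measurableTypeR R, [tuple of behead y])).
  apply/measurable_fun_pair; last exact: measurable_behead.
  exact: measurable_tnth.
apply: (pushforward_sigma_finite_measure
  (product_sigma_finite lebesgue_measure m) mf mg).
by move=> [x y]; rewrite theadE/=; congr pair; exact: val_inj.
Qed.

Section lebesgue_tuple_instances.
Variables (R : realType) (n : nat).

Let spec := cid (lebesgue_tuple_sigma_finite_measure R n).
Let m := projT1 spec.
Let mE : @lebesgue_tuple R n = m := projT2 spec.

Let leb0 : @lebesgue_tuple R n set0 = 0%E.
Proof. by rewrite mE measure0. Qed.

Let leb_ge0 A : (0 <= @lebesgue_tuple R n A)%E.
Proof. by rewrite mE measure_ge0. Qed.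

Let leb_sigma_additive : semi_sigma_additive (@lebesgue_tuple R n).
Proof. by rewrite mE; exact: measure_semi_sigma_additive. Qed.

HB.instance Definition _ := isMeasure.Build _ _ _ (@lebesgue_tuple R n)
  leb0 leb_ge0 leb_sigma_additive.

Let leb_sigma_finite : sigma_finite setT (@lebesgue_tuple R n).
Proof. by rewrite mE; exact: sigma_finiteT. Qed.

HB.instance Definition _ := Measure_isSigmaFinite.Build _ _ _
  (@lebesgue_tuple R n) leb_sigma_finite.
End lebesgue_tuple_instances.

Definition euclid_norm (R : realType) (n : nat) (x : n.-tuple R) : R :=
  Num.sqrt (\sum_(i < n) tnth x i ^+ 2).

(* S_+^(n-1) *)
Definition sphere_plus (R : realType) (n : nat) : set (n.-tuple R) :=
  [set x | euclid_norm x = 1 /\ forall i, 0 <= tnth x i].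

(* Surface measure of the unit sphere of R^n, by polar coordinates: n times the
   volume of the part of the unit ball lying over A (for n = 1, the counting
   measure of the two-point sphere). *)
Definition surface_measure (R : realType) (n : nat) (A : set (n.-tuple R)) :
    \bar R :=
  let cone := [set y : n.-tuple R | 0 < euclid_norm y <= 1 /\
    A [tuple tnth y i / euclid_norm y | i < n]] in
  (n%:R%:E * lebesgue_tuple n cone)%E.

(* n-dimensional Lebesgue measure on the hyperplane x_0 + ... + x_n = 1/2 of
   R^(n+1), parametrized by (x_1, ..., x_n); the Gram determinant of this
   parametrization is n + 1. *)
Definition hyperplane_measure (R : realType) (n : nat)
    (A : set (n.+1.-tuple R)) : \bar R :=
  let chart (x : n.-tuple R) := [tuple of 2^-1 - \sum_(i < n) tnth x i :: x] in
  ((Num.sqrt n.+1%:R)%:E * lebesgue_tuple n (chart @^-1` A))%E.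

Section projective_space.
Variables (R : realType) (n : nat).

Definition proj_space : Type :=
  {L : {vspace 'rV[R[i]]_n.+1} | \dim L == 1%N}.

HB.instance Definition _ := Choice.on proj_space.

Fact dim_line_default :
  \dim <[delta_mx 0 0 : 'rV[R[i]]_n.+1]> == 1%N.
Proof.
rewrite dim_vline; case: (eqVneq (delta_mx _ _) _) => // /matrixP/(_ 0 0).
by rewrite !mxE !eqxx => /eqP; rewrite oner_eq0.
Qed.

HB.instance Definition _ := isPointed.Build proj_space
  (exist (fun L => is_true (\dim L == 1%N)) _ dim_line_default).

(* [w]; the value at w = 0 is arbitrary *)
Definition proj_class (w : 'rV[R[i]]_n.+1) : proj_space :=
  insubd (point : proj_space) <[w]>%VS.

(* Some homogeneous coordinates; moment_map_class and affine_coord_class below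
   show that the choice is immaterial. *)
Definition proj_repr (p : proj_space) : 'rV[R[i]]_n.+1 := vpick (val p).

Lemma proj_class_reprE (w : 'rV[R[i]]_n.+1) : w != 0 ->
  exists2 c, c != 0 & proj_repr (proj_class w) = c *: w.
Proof.
move=> w0; rewrite /proj_repr /proj_class val_insubd dim_vline w0 /=.
have /vlineP[c cE] := memv_pick <[w]>%VS.
exists c => //; apply: contra w0 => /eqP c0.
move: cE; rewrite c0 scale0r => /eqP.
by rewrite vpick0 -dimv_eq0 dim_vline eqb0 negbK.
Qed.

(* C^(n+1) is identified with R^(n+1) x R^(n+1) *)
Definition cvec (m : nat) (xy : m.-tuple R * m.-tuple R) : 'rV[R[i]]_m :=
  \row_j (tnth xy.1 j +i* tnth xy.2 j)%C.

Definition cnorm (m : nat) (z : 'rV[R[i]]_m) : R :=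
  Num.sqrt (\sum_(j < m) modulus (z 0 j) ^+ 2).

(* Borel sets: quotient sigma-algebra for C^(n+1) \ {0} -> P^n *)
Definition proj_measurable (A : set proj_space) : Prop :=
  measurable [set xy : n.+1.-tuple R * n.+1.-tuple R | A (proj_class (cvec xy))].

Let proj_measurable0 : proj_measurable set0.
Proof. exact: measurable0. Qed.

Let proj_measurableC A : proj_measurable A -> proj_measurable (~` A).
Proof. by move=> mA; exact: measurableC. Qed.

Let proj_measurable_bigcup (F : (set proj_space)^nat) :
  (forall i, proj_measurable (F i)) -> proj_measurable (\bigcup_i F i).
Proof.
move=> mF; rewrite /proj_measurable.
by apply: bigcupT_measurable => k; exact: mF.
Qed.

HB.instance Definition _ := isMeasurable.Build default_measure_display
  proj_space proj_measurable0 proj_measurableC proj_measurable_bigcup.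

(* Fubini-Study volume, up to a positive constant: the unitarily invariant
   measure, image of Lebesgue measure on the unit ball of C^(n+1). *)
Definition fubini_study (A : set proj_space) : \bar R :=
  (lebesgue_tuple n.+1 \x lebesgue_tuple n.+1)%E
    [set xy | 0 < cnorm (cvec xy) <= 1 /\ A (proj_class (cvec xy))].

(* The affine coordinates z = (w_1, ..., w_n) / w_0; junk value 0 if w_0 = 0. *)
Definition affine_coord (p : proj_space) : 'rV[R[i]]_n :=
  \row_u (proj_repr p 0 (lift ord0 u) / proj_repr p 0 ord0).

(* sigma_u = |z_u| / |z|; junk value 0 if z = 0. *)
Definition sigma_coord (p : proj_space) : n.-tuple R :=
  [tuple modulus (affine_coord p 0 u) / cnorm (affine_coord p) | u < n].

Definition moment_map (p : proj_space) : n.+1.-tuple R :=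
  [tuple modulus (proj_repr p 0 j) ^+ 2 / (2 * cnorm (proj_repr p) ^+ 2)
     | j < n.+1].

Definition delzant_polytope : set (n.+1.-tuple R) := range moment_map.

Lemma modulusM (x y : R[i]) : modulus (x * y) = modulus x * modulus y.
Proof. exact: ComplexField.Normc.normcM. Qed.

Lemma cnormZ m (c : R[i]) (z : 'rV[R[i]]_m) :
  cnorm (c *: z) = modulus c * cnorm z.
Proof.
rewrite /cnorm; under eq_bigr do rewrite mxE modulusM exprMn.
rewrite -mulr_sumr sqrtrM ?sqr_ge0// sqrtr_sqr ger0_norm//.
by case: c => a b; exact: sqrtr_ge0.
Qed.

Lemma moment_map_class (w : 'rV[R[i]]_n.+1) : w != 0 ->
  moment_map (proj_class w) =
  [tuple modulus (w 0 j) ^+ 2 / (2 * cnorm w ^+ 2) | j < n.+1].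
Proof.
move=> /proj_class_reprE[c c0 cE]; apply: eq_from_tnth => j.
rewrite !tnth_mktuple cE mxE modulusM cnormZ !exprMn.
have mc0 : modulus c ^+ 2 != 0.
  rewrite expf_neq0//; apply: contra c0 => /eqP.
  by move=> /ComplexField.Normc.eq0_normc ->.
by rewrite [2 * _]mulrCA -mulf_div divff// mul1r.
Qed.

Lemma affine_coord_class (w : 'rV[R[i]]_n.+1) : w != 0 ->
  affine_coord (proj_class w) = \row_u (w 0 (lift ord0 u) / w 0 ord0).
Proof.
move=> /proj_class_reprE[c c0 cE]; apply/rowP => u.
by rewrite !mxE cE !mxE -mulf_div divff// mul1r.
Qed.

End projective_space.

Arguments sphere_plus : clear implicits.
Arguments delzant_polytope : clear implicits.

(* The representatives of the classes in L^oo(D, mu), complex-valued; their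
   values outside D are irrelevant. *)
Definition Linfty (R : realType) d (T : measurableType d)
    (mu : set T -> \bar R) (D : set T) : set (T -> R[i]) :=
  [set f : T -> R[i] | [/\ measurable_fun D (fun x => complex.Re (f x) : R),
               measurable_fun D (fun x => complex.Im (f x) : R) &
               exists M : R, \forall x \ae mu, D x -> modulus (f x) <= M]].

(* the functions on X almost everywhere equal to g \o phi for some g in F *)
Definition ae_pullback (R : realType) d (X : measurableType d)
    (T : Type) (C : Type) (mu : set X -> \bar R) (phi : X -> T)
    (F : set (T -> C)) : set (X -> C) :=
  [set h | exists2 g, F g & \forall x \ae mu, h x = g (phi x)].

(* Main.v *)
(* The squared moduli |w_u|^2, u >= 1, determine the direction sigma of
   (|w_u|)_u, so sigma is a Borel function of the moment map and f is b
   composed with it. The point is that f stays essentially bounded: the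
   coordinatewise square root pulls Lebesgue null sets of R^n back to null sets
   (its inverse is locally Lipschitz in each variable, then Fubini), and a
   surface-null set is one whose cone is Lebesgue null. *)
Require Import Defs.
From mathcomp Require Import all_boot all_order all_algebra.
From mathcomp Require Import complex.
From mathcomp Require Import all_classical all_reals all_analysis.
From mathcomp Require Import measurable_realfun lebesgue_stieltjes_measure.
From mathcomp Require Import ring lra.
Import Order.TTheory GRing.Theory Num.Theory.
Import numFieldNormedType.Exports.
Local Open Scope classical_set_scope.
Local Open Scope ring_scope.

(** * Lipschitz images of null sets and the signed square root *)

(** If an open interval of length l meets [E] at x, the image of its trace on [E] lies in the closed
    interval of length 2Kl centred at [f x]. Summing over a cover of [E] of small total length
    bounds the outer measure of the image. *)
Lemma lebesgue_measure_lipschitz_image (R : realType) (f : R -> R) (K : R)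
    (E : set R) :
  0 <= K -> {in E &, forall x y, `|f x - f y| <= K * `|x - y|} ->
  lebesgue_measure E = 0%E -> lebesgue_measure (f @` E) = 0%E.
Proof.
move=> K0 fK E0; apply/eqP; rewrite eq_le measure_ge0 andbT.
apply/lee_addgt0Pr => _/posnumP[e]; rewrite add0e.
(* The summand 1 keeps the denominator positive when [K = 0], and 2K times [e'] stays at most
   [e]. *)
pose e' := e%:num / (2 * K + 1).
have K1 : 0 < 2 * K + 1 by lra.
have e'0 : 0 < e' by rewrite divr_gt0.
have /esym Ecov := outer_measure_open_itv_cover E.
rewrite [RHS]E0 in Ecov.
(* The infimum over covers equals 0, hence is finite, so some cover comes within [e'] of it. *)
have infE := f_equal (fun x => x \is a fin_num) Ecov.
have [_ [/= F [Fitv EF] <-]] := lb_ereal_inf_adherent e'0 infE.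
rewrite Ecov add0e => Fe.
have sub : f @` E `<=` \bigcup_k (f @` (E `&` F k)).
  by move=> _ [x Ex <-]; have [k _ Fkx] := EF _ Ex; exists k => //; exists x.
apply: (le_trans (@le_outer_measure _ _ (@lebesgue_measure R) _ _ sub)).
apply: (le_trans (outer_measure_sigma_subadditive (@lebesgue_measure R) _)).
apply: (@le_trans _ _ (\sum_(0 <= k <oo) ((2 * K)%:E * wlength idfun (F k)))%E).
  apply: lee_nneseries => // k _.
  have [[a b] /= ->] := Fitv k.
  have [->|/set0P[x [Ex xab]]] := eqVneq (E `&` `]a, b[) set0.
    rewrite image_set0 [leLHS](measure0 (@lebesgue_measure R)).
    by rewrite mule_ge0 ?wlength_ge0// lee_fin mulr_ge0.
  have ab : a < b.
    by move: xab => /=; rewrite in_itv/= => /andP[]; exact: lt_trans.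
  apply: (@le_trans _ _ (lebesgue_measure
      (`[f x - K * (b - a), f x + K * (b - a)] : set R))).
    apply: (@le_outer_measure _ _ (@lebesgue_measure R)).
    move=> _ [y [Ey yab] <-] /=; rewrite in_itv/= -ler_distl.
    apply: (le_trans (fK _ _ _ _)); rewrite ?inE// ler_wpM2l//.
    move: xab yab; rewrite /= !in_itv/= ler_norml => /andP[? ?] /andP[? ?].
    by apply/andP; split; lra.
  rewrite lebesgue_measure_itv/= wlength_itv/= !lte_fin ab.
  case: ifPn => _; last by rewrite mule_ge0// ?lee_fin ?mulr_ge0// subr_ge0 ltW.
  by rewrite -!EFinB -EFinM lee_fin; lra.
rewrite nneseriesZl; last by move=> k _; exact: wlength_ge0.
apply: (@le_trans _ _ ((2 * K)%:E * e'%:E)%E).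
  by apply: lee_wpmul2l; [rewrite lee_fin mulr_ge0|exact: ltW].
by rewrite -EFinM lee_fin /e' mulrA ler_pdivrMr// mulrC ler_wpM2l//; lra.
Qed.

(* Unlike Num.sqrt, which is 0 on the negative half-line, this is injective,
   so that preimages of null sets are null on the whole of R. *)
Definition signed_sqrt {R : rcfType} (x : R) : R := Num.sqrt x - Num.sqrt (- x).

Lemma signed_sqrtK {R : rcfType} :
  cancel (@signed_sqrt R) (fun x => x * `|x|).
Proof.
move=> x; rewrite /signed_sqrt; have [x0|/ltW x0] := leP 0 x.
  rewrite (@ler0_sqrtr _ (- x)) ?oppr_le0// subr0 ger0_norm ?sqrtr_ge0//.
  by rewrite -expr2 sqr_sqrtr.
rewrite (ler0_sqrtr x0) sub0r normrN ger0_norm ?sqrtr_ge0//.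
by rewrite mulNr -expr2 sqr_sqrtr ?oppr_ge0// opprK.
Qed.

Lemma measurable_sqrt (R : realType) : measurable_fun [set: R] (@Num.sqrt R).
Proof. exact: (continuous_measurable_fun (@sqrt_continuous R)). Qed.

Lemma measurable_signed_sqrt (R : realType) :
  measurable_fun [set: measurableTypeR R]
    (@signed_sqrt R : measurableTypeR R -> measurableTypeR R).
Proof.
apply: measurable_funB; first exact: measurable_sqrt.
by apply: measurableT_comp (@measurable_sqrt R) _; exact: measurable_funN.
Qed.

(** By [signed_sqrtK] the preimage lies in the image of [A] under the map x |x|. That map is
    Lipschitz on each [-k, k], and countably many such pieces suffice. *)
Lemma lebesgue_measure_preimage_signed_sqrt (R : realType)
    (A : set (measurableTypeR R)) :
  measurable A -> lebesgue_measure A = 0%E ->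
  lebesgue_measure (@signed_sqrt R @^-1` A) = 0%E.
Proof.
move=> mA A0.
have mS : @measurable _ (measurableTypeR R) (@signed_sqrt R @^-1` A).
  by rewrite -[X in measurable X]setTI; exact: measurable_signed_sqrt.
apply: (measure_negligible mS).
pose F k : set (measurableTypeR R) :=
  (fun x : R => x * `|x|) @` (A `&` [set x : R | `|x| <= k%:R]).
apply: (@negligibleS _ (measurableTypeR R) _ _ (\bigcup_k F k)).
  move=> y /= Ay.
  have [k yk] : exists k : nat, `|signed_sqrt y| <= k%:R.
    exists (Num.truncn `|signed_sqrt y|).+1.
    by apply/ltW/truncnS_gt.
  by exists k => //; exists (signed_sqrt y); rewrite ?signed_sqrtK.
apply: negligible_bigcup => k; apply/negligible_outer_measure.
apply: (@lebesgue_measure_lipschitz_image _ _ (2 * k%:R)).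
- by rewrite mulr_ge0.
- move=> x y; rewrite !inE => -[_ /= xk] [_ /= yk].
  (* Each of the two terms is at most k |x - y|, whence the constant 2k. *)
  have -> : x * `|x| - y * `|y| = x * (`|x| - `|y|) + (x - y) * `|y| by ring.
  rewrite (le_trans (ler_normD _ _))// !normrM normr_id.
  rewrite -mulrA (mulr_natl _ 2) mulr2n lerD//.
    by rewrite ler_pM// ?ler_dist_dist.
  by rewrite mulrC ler_wpM2r.
- apply/eqP; rewrite eq_le measure_ge0 andbT -A0.
  by apply: (@le_outer_measure _ _ (@lebesgue_measure R)) => x [].
Qed.

(** * Null sets in products and under coordinatewise maps *)

(** The product measure integrates the measures of the sections, and a nonnegative function has
    integral zero exactly when it vanishes almost everywhere. *)
Lemma product_measure1_eq0P (d1 d2 : measure_display)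
    (T1 : measurableType d1) (T2 : measurableType d2) (R : realType)
    (m1 : {measure set T1 -> \bar R})
    (m2 : {sigma_finite_measure set T2 -> \bar R})
    (A : set (T1 * T2)) :
  measurable A ->
  (m1 \x m2)%E A = 0%E <-> {ae m1, forall x, m2 (xsection A x) = 0%E}.
Proof.
move=> mA; have mm := measurable_fun_xsection m2 mA.
have := ae_eq_integral_abs m1 measurableT mm.
under eq_integral do rewrite gee0_abs//.
move=> [h1 h2]; split=> [/h1|h]; first by apply: filterS => x /(_ I).
by apply: h2; apply: filterS h => x + _.
Qed.

(** The section of the preimage at x is the [f2]-preimage of the section of [A] at [f1 x]. Null
    sections stay null by the hypothesis on [f2], and the exceptional x lie in the [f1]-preimage of
    a null set. *)
Lemma product_measure1_preimage_eq0 (d1 d2 : measure_display)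
    (T1 : measurableType d1) (T2 : measurableType d2) (R : realType)
    (m1 : {measure set T1 -> \bar R})
    (m2 : {sigma_finite_measure set T2 -> \bar R})
    (f1 : T1 -> T1) (f2 : T2 -> T2)
    (A : set (T1 * T2)) :
  measurable_fun [set: T1] f1 -> measurable_fun [set: T2] f2 ->
  (forall B, measurable B -> m1 B = 0%E -> m1 (f1 @^-1` B) = 0%E) ->
  (forall B, measurable B -> m2 B = 0%E -> m2 (f2 @^-1` B) = 0%E) ->
  measurable A -> (m1 \x m2)%E A = 0%E ->
  (m1 \x m2)%E ((fun p => (f1 p.1, f2 p.2)) @^-1` A) = 0%E.
Proof.
move=> mf1 mf2 f1_null f2_null mA A0.
have mA' : measurable ((fun p : T1 * T2 => (f1 p.1, f2 p.2)) @^-1` A).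
  rewrite -[X in measurable X]setTI.
  have m : measurable_fun setT (fun p : T1 * T2 => (f1 p.1, f2 p.2)).
    apply/measurable_fun_pairP; split.
      exact: measurableT_comp mf1 measurable_fst.
    exact: measurableT_comp mf2 measurable_snd.
  exact: m.
apply/(product_measure1_eq0P _ _ _ _ _ _ _ _ mA').
have /(product_measure1_eq0P _ _ _ _ _ _ _ _ mA)[Z [mZ Z0 ZA]] := A0.
exists (f1 @^-1` Z); split; [|exact: f1_null|].
  by rewrite -[X in measurable X]setTI; exact: mf1.
move=> x /= xA; apply: ZA => /= A0'; apply: xA.
have mx : measurable (xsection A (f1 x)) by exact: measurable_xsection.
rewrite -(f2_null _ mx A0'); congr (m2 _).
Qed.
Lemma lebesgue_tupleS (R : realType) n (A : set (n.+1.-tuple R)) :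
  lebesgue_tuple n.+1 A =
  (@lebesgue_measure R \x @lebesgue_tuple R n)%E
     ((fun p : measurableTypeR R * n.-tuple R => [tuple of (p.1 : R) :: p.2])
       @^-1` A).
Proof. by []. Qed.

Lemma measurable_map_tuple d (T : measurableType d) (f : T -> T) n :
  measurable_fun setT f ->
  measurable_fun setT (fun x : n.-tuple T => [tuple of map f x]).
Proof.
move=> mf; apply/measurable_fun_tnthP => i.
rewrite (_ : _ \o _ = f \o (@tnth n T ^~ i)); last first.
  by apply/funext => x /=; rewrite tnth_map.
by apply: measurableT_comp => //; exact: measurable_tnth.
Qed.

(** Induction on [n]: the map acts by [f] on the head and by the tuple map on the tail, so the
    product lemma applies with the induction hypothesis on the second factor. *)
Lemma lebesgue_tuple_preimage_map_eq0 (R : realType) (f : R -> R) n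
    (A : set (n.-tuple R)) :
  measurable_fun setT f ->
  (forall B : set R, measurable B ->
     lebesgue_measure B = 0%E -> lebesgue_measure (f @^-1` B) = 0%E) ->
  measurable A -> lebesgue_tuple n A = 0%E ->
  lebesgue_tuple n ((fun x : n.-tuple R => [tuple of map f x]) @^-1` A) = 0%E.
Proof.
move=> mf f_null; elim: n A => [|n IH] A mA.
  rewrite (_ : _ @^-1` A = A)//; apply/funext => x /=.
  by congr (A _); rewrite [LHS]tuple0 [RHS]tuple0.
rewrite !lebesgue_tupleS => A0.
have mc : measurable_fun [set: measurableTypeR R * n.-tuple R]
    (fun p => [tuple of (p.1 : R) :: p.2]).
  have m1 : measurable_fun [set: measurableTypeR R * n.-tuple R]
      (fun p => p.1 : R) by exact: measurable_fst.
  exact: (measurable_cons m1 measurable_snd).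
(* The [0] on the right becomes the measure of the preimage in the product, which leaves two
   preimages to identify. *)
rewrite -(@product_measure1_preimage_eq0 _ _ _ _ _
  (@lebesgue_measure R) (@lebesgue_tuple R n) f
  (fun x : n.-tuple R => [tuple of map f x]) _ _ _ _ IH _ A0) //.
- congr ((_ \x _)%E _); apply/funext => p /=.
  by congr (A _); exact: val_inj.
- exact: measurable_map_tuple.
- by rewrite -[X in measurable X]setTI; exact: mc.
Qed.

(** * Radial projection onto the sphere *)

(** The same formula occurs in the cone of [surface_measure], so that cone is a preimage under
    [normalize] cut by a norm condition. *)
Definition normalize {R : realType} {n} (x : n.-tuple R) : n.-tuple R :=
  [tuple tnth x i / euclid_norm x | i < n].

Lemma euclid_norm_ge0 (R : realType) n (x : n.-tuple R) : 0 <= euclid_norm x.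
Proof. exact: sqrtr_ge0. Qed.

Lemma euclid_norm0 (R : realType) n : euclid_norm [tuple (0 : R) | _ < n] = 0.
Proof.
by rewrite /euclid_norm big1 ?sqrtr0// => i _; rewrite tnth_mktuple expr0n.
Qed.

Lemma euclid_normZ (R : realType) n (c : R) (x : n.-tuple R) : 0 <= c ->
  euclid_norm [tuple c * tnth x i | i < n] = c * euclid_norm x.
Proof.
move=> c0; rewrite /euclid_norm.
under eq_bigr do rewrite tnth_mktuple exprMn.
by rewrite -mulr_sumr sqrtrM ?sqr_ge0// sqrtr_sqr ger0_norm.
Qed.

Lemma normalizeZ (R : realType) n (c : R) (x : n.-tuple R) : 0 < c ->
  normalize [tuple c * tnth x i | i < n] = normalize x.
Proof.
move=> c0; apply: eq_from_tnth => i; rewrite !tnth_mktuple.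
by rewrite euclid_normZ ?ltW// -mulf_div divff ?gt_eqF// mul1r.
Qed.

Lemma normalize_eq0 (R : realType) n (x : n.-tuple R) :
  euclid_norm x = 0 -> normalize x = [tuple 0 | _ < n].
Proof.
by move=> x0; apply: eq_from_tnth => i; rewrite !tnth_mktuple x0 invr0 mulr0.
Qed.

Lemma normalize_sphere (R : realType) n (x : n.-tuple R) :
  (forall i, 0 <= tnth x i) -> 0 < euclid_norm x ->
  sphere_plus R n (normalize x).
Proof.
move=> x0 nx0; split=> [|i]; last by rewrite tnth_mktuple divr_ge0// ltW.
rewrite (_ : normalize x = [tuple (euclid_norm x)^-1 * tnth x i | i < n]).
  by rewrite euclid_normZ ?invr_ge0 ?ltW// mulVf// gt_eqF.
by apply: eq_from_tnth => i; rewrite !tnth_mktuple mulrC.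
Qed.

Lemma sphere_normalize_gt0 (R : realType) n (x : n.-tuple R) :
  sphere_plus R n (normalize x) -> 0 < euclid_norm x.
Proof.
move=> [+ _]; rewrite lt_neqAle euclid_norm_ge0 andbT eq_sym.
apply: contra_eq_neq => /normalize_eq0 ->.
by rewrite euclid_norm0 eq_sym oner_eq0.
Qed.

Lemma measurable_euclid_norm (R : realType) n :
  measurable_fun [set: n.-tuple R] (@euclid_norm R n).
Proof.
apply: measurableT_comp (@measurable_sqrt R) _; apply: measurable_sum => i.
by apply: measurable_funX; exact: measurable_tnth.
Qed.

Lemma measurable_normalize (R : realType) n :
  measurable_fun [set: n.-tuple R] (@normalize R n).
Proof.
apply/measurable_fun_tnthP => i.
(* Division becomes the measurable power -1; the two agree on norms, including at 0, where both give
   0. *)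
rewrite (_ : _ \o _ = fun x => tnth x i * euclid_norm x `^ (-1)); last first.
  by apply/funext => x /=; rewrite tnth_mktuple powR_inv1 ?euclid_norm_ge0.
apply: measurable_funM; first exact: measurable_tnth.
exact: measurableT_comp (@measurable_powR R (-1)) (@measurable_euclid_norm R n).
Qed.

Lemma measurable_nonneg_tuple (R : realType) n :
  measurable [set x : n.-tuple R | forall i, 0 <= tnth x i].
Proof.
rewrite (_ : mkset _ = \bigcap_(i in [set: 'I_n])
    ((@tnth n R ^~ i) @^-1` `[0, +oo[)); last first.
  apply/seteqP; split=> x /= x0 i; first by move=> _; rewrite /= in_itv/= x0.
  by have := x0 i I; rewrite /= in_itv/= andbT.
apply: fin_bigcap_measurable => // i _.
by rewrite -[X in measurable X]setTI; apply: measurable_tnth.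
Qed.

Lemma measurable_sphere_plus (R : realType) n : measurable (sphere_plus R n).
Proof.
apply: (@measurableI _ _ (@euclid_norm R n @^-1` [set 1])).
  by rewrite -[X in measurable X]setTI; exact: measurable_euclid_norm.
exact: measurable_nonneg_tuple.
Qed.

(** * Sigma as a Borel function of the moment map *)

(* The value for x_0 = 0 matches the junk value of sigma_coord on w_0 = 0, so
   that sigma_coordE holds at every point. *)
Definition sigma_chart {R : realType} {n} (x : n.+1.-tuple R) : n.-tuple R :=
  if tnth x ord0 == 0 then [tuple 0 | _ < n]
  else normalize [tuple Num.sqrt (tnth x (lift ord0 i)) | i < n].

Lemma measurable_sigma_chart (R : realType) n :
  measurable_fun [set: n.+1.-tuple R] (@sigma_chart R n).
Proof.
apply: measurable_fun_ifT => //.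
- apply: measurable_fun_eqr; [exact: measurable_tnth|exact: measurable_cst].
- apply: measurableT_comp (@measurable_normalize R n) _.
  apply/measurable_fun_tnthP => i.
  rewrite (_ : _ \o _ = Num.sqrt \o (@tnth _ R ^~ (lift ord0 i))); last first.
    by apply/funext => x /=; rewrite tnth_mktuple.
  by apply: measurableT_comp (@measurable_sqrt R) _; exact: measurable_tnth.
Qed.

Lemma modulus_ge0 (R : realType) (z : R[i]) : 0 <= modulus z.
Proof. by case: z => a b; exact: sqrtr_ge0. Qed.

Lemma modulus_eq0 (R : realType) (z : R[i]) : (modulus z == 0) = (z == 0).
Proof.
apply/eqP/eqP => [|->]; first exact: ComplexField.Normc.eq0_normc.
exact: ComplexField.Normc.normc0.
Qed.

Lemma cnorm_gt0 (R : realType) m (w : 'rV[R[i]]_m) j :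
  w 0 j != 0 -> 0 < cnorm w.
Proof.
move=> wj; rewrite sqrtr_gt0 (bigD1 j)//= ltr_pwDl ?sumr_ge0//.
- by rewrite exprn_gt0// lt_def modulus_eq0 wj modulus_ge0.
- by move=> i _; exact: sqr_ge0.
Qed.

Lemma moment_map_ge0 (R : realType) n (p : proj_space R n) j :
  0 <= tnth (moment_map p) j.
Proof.
by rewrite tnth_mktuple divr_ge0 ?mulr_ge0 ?exprn_ge0 ?modulus_ge0 ?sqrtr_ge0.
Qed.

Lemma sigma_coord_normalize (R : realType) n (p : proj_space R n) :
  sigma_coord p = normalize [tuple modulus (affine_coord p 0 u) | u < n].
Proof.
apply: eq_from_tnth => i; rewrite !tnth_mktuple; congr (_ / _).
by congr Num.sqrt; apply: eq_bigr => j _; rewrite tnth_mktuple.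
Qed.

(** For w_0 nonzero, the square roots of the moment coordinates of index at least 1 are a common
    positive multiple of the |z_u|, and [normalize] forgets the factor. *)
Lemma sigma_coordE (R : realType) n (p : proj_space R n) :
  sigma_coord p = sigma_chart (moment_map p).
Proof.
rewrite sigma_coord_normalize /sigma_chart tnth_mktuple.
set w := proj_repr p; have [w0|w0] := eqVneq (w 0 ord0) 0.
  (* Division by w_0 = 0 makes all affine coordinates 0, so both sides are the zero tuple. *)
  rewrite w0 ComplexField.Normc.normc0 expr0n mul0r eqxx normalize_eq0//.
  rewrite -[RHS](euclid_norm0 R n); congr euclid_norm; apply: eq_mktuple => i.
  by rewrite mxE -/w w0 invr0 mulr0 ComplexField.Normc.normc0.
have nw := cnorm_gt0 _ _ _ _ w0.
have mw0 : 0 < modulus (w 0 ord0) by rewrite lt_def modulus_eq0 w0 modulus_ge0.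
rewrite gt_eqF; last by rewrite divr_gt0 ?mulr_gt0 ?exprn_gt0.
(* This is the common factor: multiplied by |w_u| / |w_0| it gives |w_u| / (sqrt 2 |w|), the root of
   the moment coordinate. *)
have c0 : 0 < modulus (w 0 ord0) / (Num.sqrt 2 * cnorm w).
  by rewrite divr_gt0// mulr_gt0// sqrtr_gt0.
rewrite -[LHS](normalizeZ _ _ _ _ c0); congr normalize; apply: eq_mktuple => i.
rewrite !tnth_mktuple mxE -/w modulusM ComplexField.Normc.normcV.
set c := LHS.
have cE : modulus (w 0 (lift ord0 i)) ^+ 2 / (2 * cnorm w ^+ 2) = c ^+ 2.
  rewrite -[X in X * cnorm w ^+ 2](@sqr_sqrtr R 2)// /c; field.
  by rewrite !gt_eqF// sqrtr_gt0.
rewrite cE sqrtr_sqr ger0_norm// mulr_ge0 ?(ltW c0)//.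
by rewrite divr_ge0 ?modulus_ge0.
Qed.

(** Symbols are controlled only on [sphere_plus]; off it [sigma_chart] takes a single value, so a
    composite with it is constant there. *)
Lemma sigma_chart_sphere (R : realType) n (x : n.+1.-tuple R) :
  sphere_plus R n (sigma_chart x) \/ sigma_chart x = [tuple 0 | _ < n].
Proof.
rewrite /sigma_chart; case: ifPn => _; first by right.
set y := [tuple _ | _ < n]; have [y0|y0] := eqVneq (euclid_norm y) 0.
  by right; exact: normalize_eq0.
left; apply: normalize_sphere; last by rewrite lt_def y0 euclid_norm_ge0.
by move=> i; rewrite tnth_mktuple sqrtr_ge0.
Qed.

Lemma measurable_comp_sigma_chart (R : realType) n (D : set (n.+1.-tuple R))
    (F : n.-tuple R -> R) :
  measurable_fun (sphere_plus R n) F -> measurable_fun D (F \o sigma_chart).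
Proof.
move=> mF mD.
have mg := measurable_funTS (D := D) (@measurable_sigma_chart R n).
(* Splitting on membership in the sphere leaves [F] measurable on one piece and a constant on the
   other. *)
pose f x : R := if `[< sphere_plus R n (sigma_chart x) >]
  then F (sigma_chart x) else F [tuple 0 | _ < n].
have -> : F \o sigma_chart = f.
  apply/funext => x; rewrite /f; case: asboolP => //=.
  by have [|-> //] := sigma_chart_sphere _ _ x.
apply: (measurable_fun_if mD _ _ _ mD).
- apply: (measurable_fun_bool true).
  rewrite (_ : _ @^-1` _ = sigma_chart @^-1` sphere_plus R n); last first.
    by apply/seteqP; split => x /=; [move/asboolP|move=> ?; apply/asboolP].
  by apply: mg => //; exact: measurable_sphere_plus.
- apply: measurable_comp mF _; first exact: measurable_sphere_plus.
    by move=> _ [x [_ /= /asboolP ?] <-].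
  exact: measurable_funTS (@measurable_sigma_chart R n).
- exact: measurable_cst.
Qed.

(** * Transfer of null sets and the inclusion *)

(* In the chart of the hyperplane, sigma_chart is the coordinatewise square
   root followed by the radial projection, and x_0 >= 0 keeps the square root
   inside the unit ball. *)
Lemma negligible_hyperplane_sigma_chart (R : realType) n
    (A : set (n.-tuple R)) :
  (0 < n)%N -> measurable A -> surface_measure A = 0%E ->
  (@hyperplane_measure R n).-negligible ([set x | forall j, 0 <= tnth x j] `&`
    sigma_chart @^-1` (A `&` sphere_plus R n)).
Proof.
(* Since [n] is positive, the factor [n] of [surface_measure] is nonzero and the cone itself is
   null. *)
move=> n0 mA /eqP; rewrite /surface_measure mule_eq0 => /orP[|/eqP A0].
  by rewrite eqe pnatr_eq0 eqn0Ngt n0.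
set cone := [set y | _] in A0.
set B := _ `&` _.
have mcone : measurable cone.
  rewrite (_ : cone = @euclid_norm R n @^-1` `]0, 1] `&` normalize @^-1` A).
    apply: measurableI; rewrite -[X in measurable X]setTI.
      exact: measurable_euclid_norm.
    exact: measurable_normalize.
  by apply/seteqP; split=> x /=; rewrite in_itv/=.
have mB : measurable B.
  apply: measurableI; first exact: measurable_nonneg_tuple.
  rewrite -[X in measurable X]setTI; apply: measurable_sigma_chart => //.
  by apply: measurableI => //; exact: measurable_sphere_plus.
exists B; split => //; rewrite /hyperplane_measure.
set chart := fun x : n.-tuple R => _.
have mchart : measurable_fun setT chart.
  apply: measurable_cons => //.
  apply: measurable_funB => //; apply: measurable_sum => i.
  exact: measurable_tnth.
rewrite [X in (_ * X)%E](_ : _ = 0%E) ?mule0//.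
apply: (@subset_measure0 _ _ _ (@lebesgue_tuple R n) _
  ((fun x : n.-tuple R => [tuple of map signed_sqrt x]) @^-1` cone)).
- by rewrite -[X in measurable X]setTI; exact: mchart.
- rewrite -[X in measurable X]setTI.
  by apply: (measurable_map_tuple _ _ _ _ (@measurable_signed_sqrt R)).
- move=> y [/= y0 [Ay Sy]].
  have yE i : tnth (chart y) (lift ord0 i) = tnth y i by rewrite tnthS.
  have ge0 i : 0 <= tnth y i by rewrite -yE.
  have rE : [tuple of map signed_sqrt y] =
      [tuple Num.sqrt (tnth (chart y) (lift ord0 i)) | i < n].
    apply: eq_from_tnth => i; rewrite tnth_map tnth_mktuple yE /signed_sqrt.
    by rewrite (@ler0_sqrtr _ (- _)) ?oppr_le0// subr0.
  move: Ay Sy; rewrite /sigma_chart; case: ifPn => _.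
    (* When x_0 = 0 the chart value is the zero tuple, which is off the sphere. *)
    by move=> _ [/eqP]; rewrite euclid_norm0 eq_sym oner_eq0.
  rewrite -rE => Ay Sy; split => //.
  rewrite (sphere_normalize_gt0 _ _ _ Sy)/=.
  (* The squared norm of the root is the sum of the y_i, at most 1/2 because x_0 is nonnegative. *)
  rewrite -[leRHS]sqrtr1 ler_wsqrtr// rE.
  under eq_bigr do rewrite tnth_mktuple yE sqr_sqrtr//.
  have := y0 ord0; rewrite tnth0 subr_ge0 => /le_trans; apply.
  by rewrite invf_le1 ?ler1n.
- apply: lebesgue_tuple_preimage_map_eq0 => //.
    exact: measurable_signed_sqrt.
  exact: lebesgue_measure_preimage_signed_sqrt.
Qed.

Theorem theorem5p7 (R : realType) (n : nat) (hn : (1 <= n)%N) :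
  ae_pullback (@fubini_study R n) (@sigma_coord R n)
    (Linfty (@surface_measure R n) (sphere_plus R n))
  `<=`
  ae_pullback (@fubini_study R n) (@moment_map R n)
    (Linfty (@hyperplane_measure R n) (delzant_polytope R n)).
Proof.
move=> h [b [mRe mIm [M [A [mA A0 AM]]]] hb].
(* [sigma_coordE] holds at every point, so the exceptional set of [hb] serves again. *)
exists (b \o sigma_chart); last first.
  have [N [mN N0 Nh]] := hb; exists N; split=> // p hp.
  by apply: Nh; move: hp; rewrite /= sigma_coordE.
split; [exact: measurable_comp_sigma_chart mRe|
        exact: measurable_comp_sigma_chart mIm|].
(* The second term bounds the composite where [sigma_chart] leaves the sphere, so a larger value
   occurs only over the sphere, where it exceeds [M] and forces membership in [A]. *)
exists (Num.max M (modulus (b [tuple 0 | _ < n]))).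
have [B [mB B0 AB]] := negligible_hyperplane_sigma_chart _ _ _ hn mA A0.
exists B; split=> // x xM; apply: AB.
move: xM => /not_implyP[[p _ <-]] /negP; rewrite -ltNge gt_max => /andP[Mb b0].
have [S|E] := sigma_chart_sphere _ _ (moment_map p); last first.
  by move: b0; rewrite /= E ltxx.
split=> [j|]; first exact: moment_map_ge0.
by split=> //; apply: AM => /= /(_ S); rewrite leNgt Mb.
Qed.
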